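(* Each of the following situations occurs. (1) There exist probability densities $f,g$ on $\mathbb{R}$ with $f,g\in\mathcal{L}\setminus\mathcal{S}$, such that neither $f(x)=o(g(x))$ nor $g(x)=o(f(x))$ as $x\to\infty$, and $f*g\in\mathcal{S}$. (2a) There exist probability densities $f,g$ on $\mathbb{R}$ with $f\in\mathcal{S}$ and $g\in\mathcal{L}\setminus\mathcal{S}$, such that neither $f(x)=o(g(x))$ nor $g(x)=o(f(x))$ as $x\to\infty$, and $f*g\in\mathcal{S}$. (2b) There exist probability densities $f,g$ on $\mathbb{R}$ with $f\in\mathcal{S}$ and $g\in\mathcal{L}\setminus\mathcal{S}$, such that neither $f(x)=o(g(x))$ nor $g(x)=o(f(x))$ as $x\to\infty$, and $f*g\in\mathcal{L}\setminus\mathcal{S}$.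
   Context: For non-negative functions, $\alpha(x)\sim\beta(x)$ means $\lim_{x\to\infty}\alpha(x)/\beta(x)=1$. For probability densities $f,g$ on $\mathbb{R}$, $f*g(x)=\int_{-\infty}^{\infty}f(x-y)g(y)\,dy$ and $f^{*2}=f*f$. A non-negative measurable function $f$ on $\mathbb{R}$ is long-tailed, $f\in\mathcal{L}$, if $\lim_{x\to\infty}f(x-y)/f(x)=1$ for every $y\in\mathbb{R}$. A probability density $f$ on $\mathbb{R}$ is subexponential, $f\in\mathcal{S}$, if $f\in\mathcal{L}$ and $f^{*2}(x)\sim 2f(x)$ as $x\to\infty$. *)

(* Defs.v *)
From HB Require Import structures.
From mathcomp Require Import all_boot all_order all_algebra.
From mathcomp Require Import all_classical all_reals all_analysis.
Set Implicit Arguments.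
Unset Strict Implicit.
Unset Printing Implicit Defensive.
Import Order.TTheory GRing.Theory Num.Theory.
Import numFieldNormedType.Exports.
Local Open Scope classical_set_scope.
Local Open Scope ring_scope.

(* Lets the library's little-o notation be used along +oo. *)
Canonical pinfty_filter_on (R : numFieldType) :=
  FilterType (pinfty_nbhs R) _.

(* In the quotients below x / 0 = 0, so a quotient tending to 1 forces its
   denominator to be nonzero on some ]A, +oo[. *)
Definition asymp_equiv (R : realType) (a b : R -> R) : Prop :=
  a x / b x @[x --> +oo] --> (1 : R).

Definition prob_density (R : realType) (f : R -> R) : Prop :=
  [/\ measurable_fun [set: R] f,
      forall x, 0 <= f x &
      (\int[@lebesgue_measure R]_x (f x)%:E = 1)%E].

(* This is the real-valued integral, which is 0 where the Lebesgue integral of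
   the nonnegative integrand is +oo. For densities that happens only on a null
   set, so the result is again a density and further convolutions do not depend
   on the convention. It does not affect the limits below either: they hold only
   if the functions involved are nonzero, hence given by finite integrals, on
   some ]A, +oo[. *)
Definition convolution (R : realType) (f g : R -> R) : R -> R :=
  fun x => \int[@lebesgue_measure R]_y (f (x - y) * g y).

Definition long_tailed (R : realType) (f : R -> R) : Prop :=
  [/\ measurable_fun [set: R] f,
      forall x, 0 <= f x &
      forall y : R, f (x - y) / f x @[x --> +oo] --> (1 : R)].

Definition subexponential (R : realType) (f : R -> R) : Prop :=
  [/\ prob_density f,
      long_tailed f &
      asymp_equiv (convolution f f) (fun x => 2 * f x)].

(* Main.v *)
Require Import Defs.
From HB Require Import structures.
From mathcomp Require Import all_boot all_order all_algebra.
From mathcomp Require Import all_classical all_reals all_analysis.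
From mathcomp Require Import measurable_realfun ring lra.
Set Implicit Arguments.
Unset Strict Implicit.
Unset Printing Implicit Defensive.
Import Order.TTheory GRing.Theory Num.Theory.
Import numFieldNormedType.Exports.
Local Open Scope classical_set_scope.
Local Open Scope ring_scope.

(** The densities are the normalised functions [M x ^+ 4 / x ^+ 6] on
    [[1, +oo[], where the profile [M] is Lipschitz and lies between
    [Num.sqrt x] and [3 * x].  A Lipschitz function tending to infinity is
    long-tailed, hence so is the density; its size may range from [x ^- 4],
    where [M x = Num.sqrt x], up to order [x ^- 2], where [M x] is of order [x].

    If such a density falls to order [x ^- 4] at arbitrarily large points [x]
    but is of order [x ^- 2] on [[x / 3, 2 * x / 3]], it is not subexponential:
    two summands of middle size already contribute order [x ^- 3] to its
    self-convolution at [x] ([deep_dips_not_subexponential]).  On the other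
    hand a long-tailed density comparable to a fixed power of [x] is
    subexponential ([subexponential_power_order]).

    A dominated-convergence argument ([convolution_asymp]) shows
    that the convolution of two such densities is equivalent to their sum, in
    each of the pairs used below.  So everything reduces to the size of the sum.
    With [osc t x = x * (1 - cos (ln x - t)) + Num.sqrt x], which equals
    [Num.sqrt x] along a geometric progression of points and is of order [x] in
    between, the three pairs of profiles are the following.
    - [osc 0] and [osc pi]: each density dips where the other one is
      large, so the sum is of order [x ^- 2] and the dips disappear.
    - [id] and [osc 0]: the pure power [x ^- 2] fills the dips.
    - [Num.sqrt] and [osc 0]: the pure power [x ^- 4] is too
      small to fill the dips, and the convolution is still not
      subexponential.  The power is of the same order as the second density at
      the dips, and negligible between them, so neither density is a little-o of the
      other. *)

(** * Convolution of densities *)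

Lemma measurable_reflect {R : realType} (a : R) :
  measurable_fun [set: R] (fun x : R => a - x).
Proof. by apply: measurable_funB => //; exact: measurable_id. Qed.

Lemma measurable_fun_reflect {R : realType} (f : R -> R) (a : R) :
  measurable_fun [set: R] f -> measurable_fun [set: R] (fun x => f (a - x)).
Proof. by move=> mf; apply: measurableT_comp => //; exact: measurable_reflect. Qed.

(** Reflections generate the translations, so this single invariance of
    Lebesgue measure gives both the total mass of a convolution and its splitting
    into two symmetric halves. *)
Lemma ge0_integral_reflect {R : realType} (a : R) (F : R -> \bar R) :
  measurable_fun [set: R] F -> (forall x, (0 <= F x)%E) ->
  (\int[@lebesgue_measure R]_x F (a - x)%R = \int[@lebesgue_measure R]_x F x)%E.
Proof.
move=> mF F0.
pose r : measurableTypeR R -> measurableTypeR R := fun x => (a - x)%R.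
have mr : measurable_fun setT r by exact: measurable_reflect.
transitivity (\int[pushforward (@lebesgue_measure R) r]_x F x)%E.
  by rewrite ge0_integral_pushforward.
apply: eq_measure_integral => A mA _.
apply/esym/lebesgue_measure_unique => //= _ [[c d]] _ <-.
have -> : pushforward (@lebesgue_measure R) r `]c, d] =
    (@lebesgue_measure R) `[a - d, a - c[.
  rewrite /pushforward; congr (lebesgue_measure _).
  apply/seteqP; split => x /=; rewrite !in_itv/= /r; lra.
rewrite !lebesgue_measure_itv/= !lte_fin ltrD2l ltrN2.
by case: ifP => // _; rewrite -!EFinB; congr EFin; lra.
Qed.

(** Boundedness of one factor makes the integral defining a convolution finite
    at every point, and not only almost everywhere. *)
Definition bounded_density {R : realType} (f : R -> R) : Prop :=
  prob_density f /\ exists B : R, forall x, f x <= B.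

Section convolution_of_densities.
Context {R : realType}.
Implicit Types f g : R -> R.
Local Notation mu := (@lebesgue_measure R).

Lemma prob_density_integrable f : prob_density f -> mu.-integrable setT (EFin \o f).
Proof.
move=> [mf f0 If]; apply/integrableP; split; first exact/measurable_EFinP.
under eq_integral do rewrite /= ger0_norm//.
by rewrite If ltry.
Qed.

Lemma convolution_integrable f g x : bounded_density f -> prob_density g ->
  mu.-integrable setT (fun y => (f (x - y) * g y)%:E).
Proof.
move=> [[mf f0 _] [B fB]] gd; have [mg g0 _] := gd.
apply: (@le_integrable _ _ _ mu setT measurableT _ (fun y => B%:E * (g y)%:E)%E).
- by apply/measurable_EFinP/measurable_funM => //; exact: measurable_fun_reflect.
- move=> y _ /=; rewrite lee_fin !ger0_norm ?mulr_ge0//.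
    by rewrite ler_wpM2r.
  exact: le_trans (f0 0) (fB 0).
- by apply: integrableZl => //; exact: prob_density_integrable.
Qed.

Lemma convolutionE f g x : bounded_density f -> prob_density g ->
  (convolution f g x)%:E = (\int[mu]_y (f (x - y) * g y)%:E)%E.
Proof.
move=> bf dg; rewrite /convolution /Rintegral fineK//.
exact/integrable_fin_num/convolution_integrable.
Qed.

Lemma convolution_ge0 f g x : prob_density f -> prob_density g ->
  0 <= convolution f g x.
Proof.
by move=> [_ f0 _] [_ g0 _]; apply: Rintegral_ge0 => y _; rewrite mulr_ge0.
Qed.

Lemma convolution_le f g (B : R) x : (forall x, f x <= B) ->
  prob_density f -> prob_density g -> convolution f g x <= B.
Proof.
move=> fB df dg; rewrite -lee_fin convolutionE//; last by split=> //; exists B.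
have [mf f0 _] := df; have [mg g0 Ig] := dg.
rewrite -[leRHS]mule1 -Ig -ge0_integralZl//; last 3 first.
- exact/measurable_EFinP.
- by move=> y _; rewrite lee_fin.
- by rewrite lee_fin; exact: le_trans (f0 0) (fB 0).
apply: ge0_le_integral => //.
- by move=> y _; rewrite lee_fin mulr_ge0.
- by apply/measurable_EFinP/measurable_funM => //; exact: measurable_fun_reflect.
- by apply/measurable_EFinP/measurable_funM.
- by move=> y _; rewrite lee_fin ler_wpM2r.
Qed.

Lemma convolution_density f g : bounded_density f -> prob_density g ->
  bounded_density (convolution f g).
Proof.
move=> bf dg; have [df [B fB]] := bf.
have [mf f0 If] := df; have [mg g0 Ig] := dg.
split; last by exists B => x; exact: convolution_le.
pose F (z : measurableTypeR R * measurableTypeR R) := (f (z.1 - z.2) * g z.2)%:E.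
have mF : measurable_fun setT F.
  apply/measurable_EFinP/measurable_funM; last exact: measurableT_comp.
  apply: measurableT_comp => //.
  by apply: measurable_funB.
have F0 z : (0 <= F z)%E by rewrite lee_fin mulr_ge0.
have cE : EFin \o convolution f g = fubini_F mu F.
  by apply/funext => x /=; rewrite convolutionE.
split.
- apply/measurable_EFinP; rewrite -/(_ \o _) cE.
  exact: measurable_fun_fubini_tonelli_F.
- by move=> x; exact: convolution_ge0.
- under eq_integral do rewrite convolutionE//.
  rewrite (fubini_tonelli F)//= -[RHS]Ig.
  apply: eq_integral => y _; rewrite /F/=.
  under eq_integral do rewrite mulrC EFinM.
  rewrite ge0_integralZl//; last 3 first.
  + apply/measurable_EFinP; apply: measurableT_comp => //.
    by apply: measurable_funB.
  + by move=> x _; rewrite lee_fin.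
  + by rewrite lee_fin.
  suff -> : (\int[mu]_x (f (x - y))%:E = 1)%E by rewrite mule1.
  rewrite -[RHS]If -[RHS](@ge0_integral_reflect _ (- y) (fun x => (f x)%:E))//.
  + rewrite -[LHS](@ge0_integral_reflect _ 0 (fun x => (f (x - y))%:E)).
    * by apply: eq_integral => x _; congr (EFin (f _)); lra.
    * apply/measurable_EFinP; apply: measurableT_comp => //.
      by apply: measurable_funB.
    * by move=> x; rewrite lee_fin.
  + exact/measurable_EFinP.
Qed.

End convolution_of_densities.

(** * Long-tailed functions and the equivalence of [f * g] with [f + g] *)

Section asymptotics.
Context {R : realType}.
Implicit Types f g h s k : R -> R.
Local Notation mu := (@lebesgue_measure R).

(** Convergence at [+oo] is tested on sequences, to which the usual dominated
    convergence theorem applies. *)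
Lemma dominated_cvg_pinfty (H : R -> R -> R) k (X : R) :
  (forall x, measurable_fun setT (H x)) ->
  mu.-integrable setT (EFin \o k) ->
  (forall x y, X <= x -> `|H x y| <= k y) ->
  (forall y, H x y @[x --> +oo] --> (0 : R)) ->
  \int[mu]_y H x y @[x --> +oo] --> (0 : R).
Proof.
move=> mH ik Hk H0.
pose H' x y := if X <= x then H x y else 0.
have k0 y : 0 <= k y by exact: le_trans (Hk X y (lexx _)).
have mH' x : measurable_fun setT (H' x).
  by rewrite /H'; case: leP.
have HH' : \forall x \near +oo, H x = H' x.
  apply: filterS (nbhs_pinfty_ge (num_real X)) => x Xx.
  by apply/funext => y; rewrite /H' Xx.
suff : \int[mu]_y H' x y @[x --> +oo] --> (0 : R).
  apply: cvg_trans; apply: near_eq_cvg.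
  by apply: filterS HH' => x ->.
apply/cvg_pinftyP => u uy.
have [] := @dominated_convergence _ _ _ mu setT measurableT
    (fun n => EFin \o H' (u n)) (cst 0%:E) (EFin \o k).
- by move=> n; apply/measurable_EFinP; exact: mH'.
- exact: measurable_cst.
- apply: aeW => y _; apply: cvg_EFin; first exact: nearW.
  have : H' x y @[x --> +oo] --> (0 : R).
    apply: cvg_trans (H0 y); apply: near_eq_cvg.
    by apply: filterS HH' => x ->.
  by move=> /cvg_pinftyP /(_ u uy).
- exact: ik.
- apply: aeW => y n _; rewrite /= lee_fin /H'.
  by case: ifPn => [/Hk//|_]; rewrite normr0.
rewrite integral_cst// mul0e => _ _ /fine_cvgP[_].
by apply.
Unshelve. all: by end_near. Qed.

Lemma long_tailed_gt0 f : long_tailed f -> \forall x \near +oo, 0 < f x.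
Proof.
move=> [_ f0 /(_ 0) f1].
have /cvgrPdist_lt/(_ 1 ltr01) := f1.
apply: filterS => x; rewrite lt0r f0 andbT subr0.
by apply: contraTneq => ->; rewrite mul0r subr0 normr1 ltxx.
Qed.

Lemma long_tailed_dist f y : long_tailed f ->
  (f (x - y) - f x) / f x @[x --> +oo] --> (0 : R).
Proof.
move=> lf; have [_ f0 /(_ y) f1] := lf.
have : f (x - y) / f x - 1 @[x --> +oo] --> (1 - 1 : R).
  by apply: cvgB => //; exact: cvg_cst.
rewrite subrr; apply: cvg_trans.
apply: near_eq_cvg; apply: filterS (long_tailed_gt0 lf) => x fx /=.
by rewrite mulrBl divff// gt_eqF.
Qed.

(** With [s] the sum of two densities, this makes the increment of one of
    them negligible with respect to [s], even where that density is itself much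
    smaller than [s]. *)
Lemma long_tailed_dist_le f s y : long_tailed f -> (forall x, f x <= s x) ->
  (f (x - y) - f x) / s x @[x --> +oo] --> (0 : R).
Proof.
move=> lf fs; have /cvgr0Pnorm_le H := long_tailed_dist y lf.
apply/cvgr0Pnorm_le => e e0; have := H e e0; apply: filterS2 (long_tailed_gt0 lf).
move=> x fx; apply: le_trans; rewrite !normrM ler_wpM2l//.
have sx := lt_le_trans fx (fs x).
by rewrite !gtr0_norm ?invr_gt0// lef_pV2.
Qed.

Lemma asymp_equiv_gt0 h s : asymp_equiv h s -> (forall x, 0 <= s x) ->
  \forall x \near +oo, 0 < s x.
Proof.
move=> /cvgrPdist_lt/(_ 1 ltr01) hs s0; apply: filterS hs => x.
rewrite lt0r s0 andbT.
by apply: contraTneq => ->; rewrite invr0 mulr0 subr0 normr1 ltxx.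
Qed.

Lemma cvg_pinfty_shift (F : R -> R) y (G : set_system R) :
  F x @[x --> +oo] --> G -> F (x - y) @[x --> +oo] --> G.
Proof.
move=> Fl; apply: cvg_comp Fl.
apply/cvgryPge => A; near=> x; rewrite lerBrDr.
by near: x; apply: nbhs_pinfty_ge; exact: num_real.
Unshelve. all: by end_near. Qed.

Lemma long_tailed_asymp_equiv h s : measurable_fun setT h ->
  (forall x, 0 <= h x) -> asymp_equiv h s -> long_tailed s -> long_tailed h.
Proof.
move=> mh h0 hs ls; split => // y; have [_ s0 /(_ y) s1] := ls.
have h1 : h (x - y) / s (x - y) @[x --> +oo] --> (1 : R).
  exact: (@cvg_pinfty_shift (fun x => h x / s x)).
have h2 : (h x / s x)^-1 @[x --> +oo] --> (1^-1 : R).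
  by apply: cvgV => //; exact: oner_neq0.
have : (h (x - y) / s (x - y)) * (s (x - y) / s x) * (h x / s x)^-1
    @[x --> +oo] --> (1 * 1 * 1^-1 : R).
  by apply: cvgM => //; apply: cvgM.
rewrite invr1 !mulr1; apply: cvg_trans; apply: near_eq_cvg.
have sy : \forall x \near +oo, 0 < s (x - y).
  have H : (x - y) @[x --> +oo] --> +oo.
    exact: (@cvg_pinfty_shift (fun x => x)).
  exact: (H _ (long_tailed_gt0 ls)).
apply: filterS2 (long_tailed_gt0 ls) sy => x /gt_eqF/negbT sx /gt_eqF/negbT sy /=.
by rewrite invf_div !mulrA divfK// divfK.
Qed.

Lemma long_tailedD f g : long_tailed f -> long_tailed g ->
  long_tailed (fun x => f x + g x).
Proof.
move=> lf lg; have [mf f0 _] := lf; have [mg g0 _] := lg.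
split; [exact: measurable_funD | by move=> x; rewrite addr_ge0 |] => y.
have : (f (x - y) - f x) / (f x + g x) + (g (x - y) - g x) / (f x + g x) + 1
    @[x --> +oo] --> (0 + 0 + 1 : R).
  apply: cvgD; last exact: cvg_cst.
  by apply: cvgD; apply: long_tailed_dist_le => // x; rewrite ?lerDl ?lerDr.
rewrite !add0r; apply: cvg_trans; apply: near_eq_cvg.
apply: filterS (long_tailed_gt0 lf) => x fx /=.
by field; rewrite gt_eqF// ltr_pwDl.
Qed.

(** The part of the convolution in which [g] takes the smaller argument; the
    rest is the same quantity with the factors exchanged. *)
Definition half_convolution f g x :=
  \int[mu]_(y in `]-oo, x / 2[) (f (x - y) * g y).

Lemma half_convolutionE f g x : half_convolution f g x =
  \int[mu]_y (if y < x / 2 then f (x - y) * g y else 0).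
Proof.
rewrite /half_convolution Rintegral_mkcond; apply: eq_Rintegral => y _.
by rewrite patchE mem_setE in_itv.
Qed.

Lemma truncated_integrand_measurable f g x (p : R -> bool) :
  measurable_fun setT f -> measurable_fun setT g -> measurable_fun setT p ->
  measurable_fun setT (fun y => if p y then f (x - y) * g y else 0).
Proof.
move=> mf mg mp; apply: measurable_fun_ifT => //.
by apply: measurable_funM => //; exact: measurable_fun_reflect.
Qed.

Lemma truncated_integrand_integrable f g x (p : R -> bool) :
  bounded_density f -> prob_density g -> measurable_fun setT p ->
  mu.-integrable setT (fun y => (if p y then f (x - y) * g y else 0)%:E).
Proof.
move=> bf dg mp; have [[mf f0 _] _] := bf; have [mg g0 _] := dg.
apply: le_integrable (convolution_integrable x bf dg) => //.
  by apply/measurable_EFinP; exact: truncated_integrand_measurable.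
move=> y _; rewrite lee_fin; case: ifP => // _.
by rewrite normr0.
Qed.

Lemma measurable_lt_half (x : R) : measurable_fun [set: R] (fun y : R => y < x / 2).
Proof. by apply: measurable_fun_ltr. Qed.

(** On the half [y < x / 2], long-tailedness gives [f (x - y) ~ f x] for each
    fixed [y], and [g] integrates to 1; the bound by [s x * k y] is what
    dominated convergence needs. *)
Lemma half_convolution_asymp f g s k (X : R) :
  bounded_density f -> prob_density g -> long_tailed f ->
  (forall x, f x <= s x) -> mu.-integrable setT (EFin \o k) ->
  (forall x y, X <= x -> y < x / 2 -> f (x - y) * g y <= s x * k y) ->
  (half_convolution f g x - f x) / s x @[x --> +oo] --> (0 : R).
Proof.
move=> bf dg lf fs ik Hk; have [[mf f0 _] _] := bf; have [mg g0 Ig] := dg.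
pose H x y := ((if y < x / 2 then f (x - y) else 0) - f x) / s x * g y.
have s0 x : 0 <= s x by exact: le_trans (f0 x) (fs x).
have IH x : \int[mu]_y H x y = (half_convolution f g x - f x) / s x.
  have i1 := truncated_integrand_integrable x bf dg (measurable_lt_half x).
  have i2 := prob_density_integrable dg.
  rewrite half_convolutionE.
  have -> : f x = \int[mu]_y (f x * g y).
    by rewrite RintegralZl// /Rintegral Ig mulr1.
  have i3 : mu.-integrable setT (EFin \o (fun y => f x * g y)).
    exact: (integrableZl measurableT (f x) i2).
  rewrite -RintegralB// -RintegralZr//; last exact: (integrableB measurableT i1 i3).
  by apply: eq_Rintegral => y _; rewrite /H; case: ifP => _; ring.
have : \int[mu]_y H x y @[x --> +oo] --> (0 : R).
  apply: (@dominated_cvg_pinfty _ (fun y => `|k y| + g y) X).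
  - move=> x; apply: measurable_funM => //; apply: measurable_funM => //.
    apply: measurable_funB => //; apply: measurable_fun_ifT => //.
      exact: measurable_lt_half.
    exact: measurable_fun_reflect.
  - exact: (integrableD measurableT (integrable_abse ik) (prob_density_integrable dg)).
  - move=> x y Xx; rewrite /H; have := s0 x; rewrite le_eqVlt => /predU1P[<-|sx].
      by rewrite invr0 mulr0 mul0r normr0 addr_ge0.
    have fx : f x / s x <= 1 by rewrite ler_pdivrMr// mul1r.
    have fx0 : 0 <= f x / s x by rewrite divr_ge0// ltW.
    case: ifPn => [yx|_]; last first.
      rewrite sub0r !mulNr normrN ger0_norm; last by rewrite mulr_ge0.
      by rewrite (le_trans (ler_wpM2r (g0 y) fx))// mul1r lerDr.
    have -> : (f (x - y) - f x) / s x * g y =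
      f (x - y) * g y / s x - f x / s x * g y by ring.
    apply: le_trans (ler_normB _ _) _; apply: lerD.
      rewrite ger0_norm ?divr_ge0 ?mulr_ge0 ?(ltW sx)// ler_pdivrMr// [leRHS]mulrC.
      apply: (le_trans (Hk _ _ Xx yx)); rewrite ler_wpM2l//; exact: ler_norm.
    rewrite ger0_norm; last by rewrite mulr_ge0.
    by rewrite (le_trans (ler_wpM2r (g0 y) fx))// mul1r.
  - move=> y.
    have : (f (x - y) - f x) / s x * g y @[x --> +oo] --> (0 * g y : R).
      by apply: cvgM; [exact: long_tailed_dist_le | exact: cvg_cst].
    rewrite mul0r; apply: cvg_trans; apply: near_eq_cvg.
    apply: filterS (nbhs_pinfty_gt (num_real (2 * y))) => x xy.
    by rewrite /H ifT//; lra.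
apply: cvg_trans; apply: near_eq_cvg; exact: nearW.
Qed.

Lemma convolution_half f g x : bounded_density f -> bounded_density g ->
  convolution f g x = half_convolution f g x + half_convolution g f x.
Proof.
move=> bf bg; have [df _] := bf; have [dg _] := bg.
have [mf f0 _] := df; have [mg g0 _] := dg.
have mp := measurable_lt_half x.
have mp' : measurable_fun [set: R] (fun y : R => x / 2 <= y).
  by apply: measurable_fun_ler.
have -> : half_convolution g f x =
    \int[mu]_y (if x / 2 <= y then f (x - y) * g y else 0).
  (* Reflection exchanges open and closed half-lines: the point [x / 2] is null. *)
  rewrite /half_convolution Rintegral_itv_bndo_bndc; last first.
    exact: integrableS (convolution_integrable x bg df).
  rewrite Rintegral_mkcond /Rintegral; congr fine.
  rewrite -[RHS](@ge0_integral_reflect _ x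
    (fun y => (if x / 2 <= y then f (x - y) * g y else 0)%:E)).
  - apply: eq_integral => y _; rewrite patchE mem_setE in_itv/= subKr.
    by rewrite [f y * _]mulrC; congr (if _ then _ else _)%:E; apply/idP/idP; lra.
  - by apply/measurable_EFinP; exact: truncated_integrand_measurable.
  - by move=> y; rewrite lee_fin; case: ifP => // _; rewrite mulr_ge0.
rewrite half_convolutionE -RintegralD//; last 2 first.
- exact: truncated_integrand_integrable.
- exact: truncated_integrand_integrable.
by apply: eq_Rintegral => y _; case: ltP; rewrite ?addr0 ?add0r.
Qed.

Lemma convolution_asymp f g k (X : R) :
  bounded_density f -> bounded_density g -> long_tailed f -> long_tailed g ->
  mu.-integrable setT (EFin \o k) ->
  (forall x y, X <= x -> y < x / 2 -> f (x - y) * g y <= (f x + g x) * k y) ->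
  (forall x y, X <= x -> y < x / 2 -> g (x - y) * f y <= (f x + g x) * k y) ->
  asymp_equiv (convolution f g) (fun x => f x + g x).
Proof.
move=> bf bg lf lg ik Hf Hg; have [df _] := bf; have [dg _] := bg.
have [_ f0 _] := df; have [_ g0 _] := dg.
have : (half_convolution f g x - f x) / (f x + g x) +
    (half_convolution g f x - g x) / (f x + g x) + 1 @[x --> +oo] --> (0 + 0 + 1 : R).
  apply: cvgD; last exact: cvg_cst.
  apply: cvgD.
    by apply: half_convolution_asymp ik Hf => // x; rewrite lerDl.
  by apply: half_convolution_asymp ik Hg => // x; rewrite lerDr.
rewrite !add0r; apply: cvg_trans; apply: near_eq_cvg.
apply: filterS (long_tailed_gt0 lf) => x fx /=; rewrite convolution_half//.
by field; rewrite gt_eqF// ltr_pwDl.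
Qed.

End asymptotics.

(** * Criteria for subexponentiality and for its failure *)

Section criteria.
Context {R : realType}.
Implicit Types f g h s : R -> R.
Local Notation mu := (@lebesgue_measure R).

Definition power_order (p : nat) f := exists c C X : R,
  [/\ 0 < c, 0 < C & forall x, X <= x -> c / x ^+ p <= f x <= C / x ^+ p].

Lemma asymp_equiv_bounds h s : asymp_equiv h s -> (forall x, 0 <= s x) ->
  exists A : R, forall x, A <= x -> 2^-1 * s x <= h x <= 2 * s x.
Proof.
move=> hs s0; have s_gt0 := asymp_equiv_gt0 hs s0.
have h2 : (0 < 2^-1 :> R) by rewrite invr_gt0.
have /cvgrPdist_lt/(_ _ h2) H := hs.
have [A [_ HA]] := filterI s_gt0 H.
exists (A + 1) => x Ax; have [sx] := HA x (lt_le_trans (ltr_pwDr ltr01 (lexx A)) Ax).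
rewrite ltr_norml => /andP[h1 h3].
apply/andP; split; first by rewrite -ler_pdivlMr//; lra.
by rewrite -ler_pdivrMr//; lra.
Qed.

Lemma power_order_asymp_equiv p h s : asymp_equiv h s -> (forall x, 0 <= s x) ->
  power_order p s -> power_order p h.
Proof.
move=> hs s0 [c [C [X [c0 C0 sX]]]].
have [A hA] := asymp_equiv_bounds hs s0.
exists (2^-1 * c), (2 * C), (Num.max A X); split; rewrite ?mulr_gt0 ?invr_gt0// => x.
rewrite ge_max => /andP[Ax Xx].
have /andP[h1 h2] := hA _ Ax; have /andP[s1 s2] := sX _ Xx.
rewrite -!mulrA; apply/andP; split.
  by apply: le_trans h1; rewrite ler_wpM2l// invr_ge0.
by apply: (le_trans h2); rewrite ler_wpM2l.
Qed.

(** Comparability with a power gives [f (x - y) <= K * f x] for [y < x / 2],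
    so that [K * f] itself is the dominating function. *)
Lemma subexponential_power_order p f : bounded_density f ->
  (forall x, x < 0 -> f x = 0) -> long_tailed f -> power_order p f ->
  subexponential f.
Proof.
move=> bf fN lf [c [C [X [c0 C0 fX]]]]; have [df _] := bf; have [_ f0 _] := df.
pose K := C * 2 ^+ p / c.
have K0 : 0 <= K by rewrite divr_ge0 ?mulr_ge0 ?exprn_ge0 ?ltW.
split => //; rewrite /asymp_equiv.
have -> : (fun x => convolution f f x / (2 * f x)) =
    (fun x => convolution f f x / (f x + f x)).
  by apply/funext => x; rewrite mulr_natl.
have H x y : Num.max 1 (2 * X) <= x -> y < x / 2 ->
    f (x - y) * f y <= (f x + f x) * (K * f y).
  rewrite ge_max => /andP[x1 xX] yx; have [y0|y0] := ltP y 0.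
    by rewrite (fN _ y0) !mulr0.
  rewrite mulrA ler_wpM2r//.
  have x0 : 0 < x by lra.
  have /andP[_ /le_trans->//] : c / (x - y) ^+ p <= f (x - y) <= C / (x - y) ^+ p.
    by apply: fX; lra.
  apply: (@le_trans _ _ (C / (x / 2) ^+ p)).
    rewrite ler_wpM2l ?(ltW C0)// lef_pV2 ?posrE ?exprn_gt0 ?divr_gt0//; last lra.
    by rewrite lerXn2r ?nnegrE ?divr_ge0 ?(ltW x0)//; lra.
  have /andP[fx _] : c / x ^+ p <= f x <= C / x ^+ p by apply: fX; lra.
  apply: (@le_trans _ _ (f x * K)); last by rewrite ler_wpM2r// lerDl.
  apply: le_trans (ler_wpM2r K0 fx); rewrite /K le_eqVlt; apply/orP; left; apply/eqP.
  rewrite expr_div_n; field.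
  by rewrite !gt_eqF// exprn_gt0.
apply: (convolution_asymp (k := fun y => K * f y) bf bf lf lf _ H H).
exact: (integrableZl measurableT K (prob_density_integrable df)).
Qed.

(** The exponents matter only through [4 > 3]: the middle third of the
    self-convolution at [x] is at least of order [(x ^- 2) ^+ 2 * x]. *)
Definition deep_dips h := exists c C : R, [/\ 0 < c, 0 < C &
  forall A : R, exists2 x, A <= x & h x <= C / x ^+ 4 /\
    forall y, x / 3 <= y <= 2 * x / 3 -> c / x ^+ 2 <= h y].

Lemma deep_dips_asymp_equiv h s : asymp_equiv h s -> (forall x, 0 <= s x) ->
  deep_dips s -> deep_dips h.
Proof.
move=> hs s0 [c [C [c0 C0 dip]]].
have [A hA] := asymp_equiv_bounds hs s0.
exists (2^-1 * c), (2 * C); split; rewrite ?mulr_gt0 ?invr_gt0// => B.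
have [x] := dip (Num.max 0 (Num.max (3 * A) (Num.max A B))).
rewrite !ge_max => /and4P[x0 x3A xA xB] [sx sy].
exists x => //; split.
  have /andP[_ /le_trans->//] := hA _ xA.
  by rewrite -mulrA ler_wpM2l.
move=> y xy; have Ay : A <= y by lra.
have /andP[hy _] := hA _ Ay; apply: le_trans hy.
by rewrite -mulrA ler_wpM2l ?invr_ge0// sy.
Qed.

Lemma convolution_ge f g x (a b m : R) : bounded_density f -> prob_density g ->
  0 <= m -> a <= b -> (forall y, a <= y <= b -> m <= f (x - y) * g y) ->
  m * (b - a) <= convolution f g x.
Proof.
move=> bf dg m0 ab H; have [[mf f0 _] _] := bf; have [mg g0 _] := dg.
rewrite -lee_fin convolutionE//.
have mfg : measurable_fun setT (fun y : R => (f (x - y) * g y)%:E).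
  by apply/measurable_EFinP/measurable_funM => //; exact: measurable_fun_reflect.
apply: (@le_trans _ _ (\int[mu]_(y in `[a, b]) (f (x - y) * g y)%:E)%E); last first.
  apply: ge0_subset_integral => //.
  by move=> y _; rewrite lee_fin mulr_ge0.
have -> : (m * (b - a))%:E = (\int[mu]_(y in `[a, b]) (cst m%:E) y)%E.
  rewrite integral_cst//= lebesgue_measure_itv/= lte_fin EFinM.
  move: ab; rewrite le_eqVlt => /predU1P[->|ab]; first by rewrite ltxx subrr.
  by rewrite ab.
apply: ge0_le_integral => //.
by apply: measurable_funTS.
Qed.

Lemma deep_dips_not_subexponential h : bounded_density h -> deep_dips h ->
  ~ subexponential h.
Proof.
move=> bh [c [C [c0 C0 dip]]] [dh lh eh]; have [_ h0 _] := dh.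
have [A hA] := asymp_equiv_bounds eh (fun x => mulr_ge0 (ler0n _ 2) (h0 x)).
pose B := 12 * C / c ^+ 2 + 1.
have [x] := dip (Num.max A (Num.max 1 B)); rewrite !ge_max => /and3P[xA x1 xB] [hx hy].
have x0 : 0 < x by lra.
have /andP[_ hh] := hA _ xA.
have : (c / x ^+ 2) ^+ 2 * (2 * x / 3 - x / 3) <= convolution h h x.
  have cx0 : 0 <= c / x ^+ 2 by rewrite divr_ge0 ?exprn_ge0 ?ltW.
  apply: convolution_ge => //; [exact: exprn_ge0 | lra |].
  move=> y xy; rewrite expr2; apply: ler_pM => //; last exact: hy.
  by apply: hy; lra.
move=> /le_trans/(_ hh)/le_trans/(_ (ler_wpM2l (ler0n _ 2) (ler_wpM2l (ler0n _ 2) hx))).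
have -> : (c / x ^+ 2) ^+ 2 * (2 * x / 3 - x / 3) = (c ^+ 2 * x / 3) / x ^+ 4.
  by field; rewrite gt_eqF.
rewrite !mulrA ler_pM2r ?invr_gt0 ?exprn_gt0//.
move: xB; rewrite /B -lerBrDr ler_pdivrMr ?exprn_gt0// => xB.
have := exprn_gt0 2 c0; nra.
Qed.

Lemma not_littleo f g (c : R) : 0 < c ->
  (forall A : R, exists2 x, A <= x & 0 < g x /\ c * g x <= f x) ->
  ~ (f =o_+oo g).
Proof.
move=> c0 H /eqoP/(_ (c / 2)).
rewrite divr_gt0// => /(_ isT) [A [_ fg]].
have [x Ax [gx fx]] := H (A + 1).
have /= := fg x (lt_le_trans (ltr_pwDr ltr01 (lexx A)) Ax).
rewrite (gtr0_norm gx) => /(le_trans (ler_norm _)); nra.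
Qed.

End criteria.

(** * Densities built from Lipschitz profiles *)

Section profiles.
Context {R : realType}.
Implicit Types M N : R -> R.
Local Notation mu := (@lebesgue_measure R).

Definition profile M := [/\ measurable_fun [set: R] M,
  forall x, 1 <= x -> Num.sqrt x <= M x <= 3 * x &
  forall x z, 1 <= x -> 1 <= z -> `|M x - M z| <= 4 * `|x - z|].

Definition profile_weight M x : R := if 1 <= x then M x ^+ 4 / x ^+ 6 else 0.

Definition profile_mass M : R := \int[mu]_x profile_weight M x.

Definition profile_density M x := profile_weight M x / profile_mass M.

Lemma sqrt_ge1 (x : R) : 1 <= x -> 1 <= Num.sqrt x <= x.
Proof.
move=> x1; have s1 : 1 <= Num.sqrt x by rewrite -[leLHS]sqrtr1 ler_wsqrtr.
by rewrite s1/= -{2}(sqr_sqrtr (le_trans ler01 x1)) expr2 ler_peMr// (le_trans ler01).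
Qed.

Lemma profile_ge1 M x : profile M -> 1 <= x -> 1 <= M x.
Proof.
move=> [_ Mb _] x1; have /andP[+ _] := Mb x x1; apply: le_trans.
by have /andP[] := sqrt_ge1 x1.
Qed.

Lemma profile_weight_ge0 M x : 0 <= profile_weight M x.
Proof.
rewrite /profile_weight; case: ifPn => // x1.
by rewrite divr_ge0// exprn_even_ge0.
Qed.

(** On [[1, +oo[] the inverse is written [expR (- ln x)], whose measurability
    follows from that of [ln]. *)
Lemma profile_weight_measurable M : profile M ->
  measurable_fun [set: R] (profile_weight M).
Proof.
move=> [mM _ _].
have -> : profile_weight M =
    (fun x => if 1 <= x then M x ^+ 4 * expR (- ln x) ^+ 6 else 0).
  apply/funext => x; rewrite /profile_weight; case: ifPn => // x1.
  by rewrite expRN lnK ?posrE ?(lt_le_trans ltr01)// exprVn.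
apply: measurable_fun_ifT => //; first by apply: measurable_fun_ler.
apply: measurable_funM; apply: measurable_funX => //.
by apply: measurableT_comp => //; apply: measurableT_comp.
Qed.

Lemma profile_weight_le M x : profile M -> 1 <= x ->
  profile_weight M x <= 81 / x ^+ 2.
Proof.
move=> pM x1; have [_ /(_ x x1)/andP[_ Mx] _] := pM.
have x0 : 0 < x by lra.
rewrite /profile_weight x1 ler_pdivrMr ?exprn_gt0//.
have -> : 81 / x ^+ 2 * x ^+ 6 = (3 * x) ^+ 4 by field; rewrite gt_eqF.
by rewrite lerXn2r ?nnegrE ?mulr_ge0// ?(le_trans ler01 (profile_ge1 pM x1))// ltW.
Qed.

Lemma profile_weight_ge M x : profile M -> 1 <= x ->
  1 / x ^+ 4 <= profile_weight M x.
Proof.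
move=> pM x1; have [_ /(_ x x1)/andP[Mx _] _] := pM.
have x0 : 0 < x by lra.
rewrite /profile_weight x1 ler_pdivlMr ?exprn_gt0//.
have -> : 1 / x ^+ 4 * x ^+ 6 = (Num.sqrt x) ^+ 4.
  by rewrite (exprM (Num.sqrt x) 2 2) sqr_sqrtr ?ltW//; field; rewrite gt_eqF.
by rewrite lerXn2r ?nnegrE ?sqrtr_ge0// (le_trans ler01 (profile_ge1 pM x1)).
Qed.

(** The weight is at most [81 / x ^+ 2], hence at most [162 / (1 + x ^+ 2)],
    whose integral is an arctangent. *)
Lemma profile_weight_integrable M : profile M ->
  mu.-integrable setT (EFin \o profile_weight M).
Proof.
move=> pM; have mw := profile_weight_measurable pM.
apply/integrableP; split; first exact/measurable_EFinP.
under eq_integral do rewrite /= ger0_norm ?profile_weight_ge0//.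
pose q (x : R) : \bar R := (162%:E * ((oneDsqr x)^-1)%:E)%E.
have mV : measurable_fun [set: R] (fun x : R => ((oneDsqr x)^-1)%:E).
  apply/measurable_EFinP; apply: continuous_measurable_fun.
  exact: continuous_oneDsqrV.
have mq (D : set R) : measurable_fun D q.
  by apply: measurable_funTS; apply: measurable_funeM.
have q0 x : (0 <= q x)%E.
  by rewrite lee_fin mulr_ge0// invr_ge0 (le_trans ler01)// oneDsqr_ge1.
have qy : (\int[mu]_(x in `[0%R, +oo[) q x < +oo)%E.
  rewrite ge0_integralZl//.
  - by rewrite integral0y_oneDsqr -EFinM ltry.
  - exact: measurable_funTS.
rewrite integral_mkcond in qy; apply: le_lt_trans qy.
apply: ge0_le_integral => //.
- by move=> x _; rewrite lee_fin profile_weight_ge0.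
- exact/measurable_EFinP.
- exact: ((measurable_restrictT q (measurable_itv _)).1 (mq _)).
move=> x _; rewrite patchE mem_setE in_itv/= andbT.
rewrite /profile_weight; case: ifPn => [x1|_]; last by case: ifP.
have x0 : 0 < x by lra.
rewrite (ltW x0) /q -EFinM lee_fin.
have := profile_weight_le pM x1; rewrite /profile_weight x1 => /le_trans; apply.
rewrite /oneDsqr ler_pdivrMr ?exprn_gt0// mulrAC ler_pdivlMr; nra.
Qed.

(** The weight is at least [1 / 16] on [[1, 2]]. *)
Lemma profile_mass_gt0 M : profile M -> 0 < profile_mass M.
Proof.
move=> pM; have iw := profile_weight_integrable pM.
have mw := profile_weight_measurable pM.
apply: (@lt_le_trans _ _ (1 / 16)); first by lra.
rewrite -lee_fin /profile_mass /Rintegral fineK; last exact: integrable_fin_num.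
apply: (@le_trans _ _ (\int[mu]_(x in `[1%R, 2%R]) (profile_weight M x)%:E)%E); last first.
  apply: ge0_subset_integral => //; first exact/measurable_EFinP.
  by move=> x _; rewrite lee_fin profile_weight_ge0.
have -> : (1 / 16)%:E = (\int[mu]_(x in `[1%R, 2%R]) (cst (1 / 16 : R)%:E) x)%E.
  rewrite integral_cst//= lebesgue_measure_itv/= lte_fin ltr1n -EFinD -EFinM.
  by congr EFin; lra.
apply: ge0_le_integral => //.
- by move=> x _; rewrite lee_fin.
- by apply: measurable_funTS; exact/measurable_EFinP.
move=> x; rewrite /= in_itv/= => /andP[x1 x2]; rewrite lee_fin.
apply: le_trans (profile_weight_ge pM x1); rewrite ler_pM2l//.
have x0 : 0 < x by lra.
rewrite lef_pV2 ?posrE ?exprn_gt0//.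
have -> : (16 : R) = 2 ^+ 4 by ring.
by rewrite lerXn2r ?nnegrE// ltW.
Qed.

Lemma profile_densityE M x : 1 <= x ->
  profile_density M x = (M x ^+ 4 / x ^+ 6) / profile_mass M.
Proof. by move=> x1; rewrite /profile_density /profile_weight x1. Qed.

Lemma profile_density_lt0 M x : x < 0 -> profile_density M x = 0.
Proof.
by move=> x0; rewrite /profile_density /profile_weight ifF ?mul0r//; lra.
Qed.

Lemma profile_density_bounded M : profile M -> bounded_density (profile_density M).
Proof.
move=> pM; have m0 := profile_mass_gt0 pM.
have iw := profile_weight_integrable pM.
have mw := profile_weight_measurable pM.
split; last first.
  exists (81 / profile_mass M) => x; rewrite ler_pM2r ?invr_gt0//.
  have [x1|x1] := leP 1 x; last by rewrite /profile_weight ifF//; lra.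
  apply: le_trans (profile_weight_le pM x1) _.
  by rewrite ler_pdivrMr ?exprn_gt0 ?(lt_le_trans ltr01)// ler_peMr// exprn_ege1.
split.
- by apply: measurable_funM.
- by move=> x; rewrite divr_ge0 ?profile_weight_ge0// ltW.
- have : \int[mu]_x (profile_weight M x / profile_mass M) = 1.
    by rewrite RintegralZr// divff// gt_eqF.
  have i' : mu.-integrable setT (fun x => (profile_weight M x / profile_mass M)%:E).
    exact: (integrableZr measurableT (profile_mass M)^-1 iw).
  by rewrite /Rintegral => <-; rewrite fineK//; exact: integrable_fin_num.
Qed.

(** [M] moves by at most [4 * `|y|] while [M x >= Num.sqrt x] tends to
    infinity. *)
Lemma profile_ratio M (y : R) : profile M ->
  M (x - y) / M x @[x --> +oo] --> (1 : R).
Proof.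
move=> pM; have [_ Mb ML] := pM.
apply/cvgrPdist_le => e e0.
pose A := (4 * `|y| / e) ^+ 2.
apply: filterS (nbhs_pinfty_ge (num_real (Num.max (1 + `|y|) A))) => x.
rewrite ge_max => /andP[xy xA].
have y0 := ler_norm y; have y0' := normr_ge0 y.
have x1 : 1 <= x by lra.
have xy1 : 1 <= x - y by lra.
have Mx := lt_le_trans ltr01 (profile_ge1 pM x1).
have -> : 1 - M (x - y) / M x = (M x - M (x - y)) / M x by field; rewrite gt_eqF.
rewrite normrM normfV (gtr0_norm Mx) ler_pdivrMr//.
apply: le_trans (ML _ _ x1 xy1) _; rewrite subKr.
rewrite mulrC -ler_pdivrMl//.
have /andP[sM _] := Mb x x1; apply: le_trans sM.
have -> : e^-1 * (`|y| * 4) = Num.sqrt A.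
  rewrite sqrtr_sqr (@ger0_norm _ (4 * `|y| / e)); first by ring.
  by rewrite divr_ge0 ?(ltW e0)// mulr_ge0.
by rewrite ler_wsqrtr.
Qed.

Lemma profile_id : profile id.
Proof.
split.
- exact: measurable_id.
- by move=> x x1; have /andP[] := sqrt_ge1 x1; move=> _ ->; lra.
- by move=> x z _ _; rewrite ler_peMl// ler1n.
Qed.

Lemma profile_long_tailed M : profile M -> long_tailed (profile_density M).
Proof.
move=> pM; have [[mf f0 _] _] := profile_density_bounded pM.
split => // y.
have m0 := profile_mass_gt0 pM.
have iV : ((x - y) / x)^-1 @[x --> +oo] --> (1^-1 : R).
  by apply: cvgV; [exact: oner_neq0 | exact: (profile_ratio y profile_id)].
have : (M (x - y) / M x) ^+ 4 * (((x - y) / x)^-1) ^+ 6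
    @[x --> +oo] --> (1 ^+ 4 * (1^-1) ^+ 6 : R).
  apply: cvgM.
    exact: (cvg_comp _ _ (profile_ratio y pM) (@exprn_continuous _ 4 1)).
  exact: (cvg_comp _ _ iV (@exprn_continuous _ 6 1^-1)).
rewrite invr1 !expr1n mulr1; apply: cvg_trans; apply: near_eq_cvg.
apply: filterS (nbhs_pinfty_ge (num_real (1 + `|y|))) => x xy.
have y0 := ler_norm y; have y0' := normr_ge0 y.
have x1 : 1 <= x by lra.
have xy1 : 1 <= x - y by lra.
have Mx := lt_le_trans ltr01 (profile_ge1 pM x1).
have x0 := lt_le_trans ltr01 x1; have xy0 := lt_le_trans ltr01 xy1.
rewrite !profile_densityE//; field.
by rewrite !gt_eqF.
Qed.

End profiles.

(** * Convolutions of profile densities *)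

Section profile_convolutions.
Context {R : realType}.
Implicit Types M N : R -> R.
Local Notation mu := (@lebesgue_measure R).

Lemma profile_density_ge0 M x : profile M -> 0 <= profile_density M x.
Proof. by move=> /profile_density_bounded[[]]. Qed.

Lemma exprD4_le (p q : R) : (p + q) ^+ 4 <= 8 * (p ^+ 4 + q ^+ 4).
Proof.
have sq (u v : R) : (u + v) ^+ 2 <= 2 * (u ^+ 2 + v ^+ 2).
  by have := sqr_ge0 (u - v); nra.
apply: (@le_trans _ _ ((2 * (p ^+ 2 + q ^+ 2)) ^+ 2)).
  rewrite (exprM _ 2 2) lerXn2r ?nnegrE ?sqr_ge0//.
  by rewrite mulr_ge0// addr_ge0// sqr_ge0.
have := sq (p ^+ 2) (q ^+ 2); rewrite exprMn; nra.
Qed.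

(** Taking fourth powers in the hypothesis turns [y ^- 6] into [y ^- 2], which
    is integrable; the dominating function is a multiple of the weight of the
    profile [id], equal to [y ^- 2] for [1 <= y]. *)
Lemma profile_density_mul_le M N (K x y : R) : profile M -> profile N ->
  0 <= K -> 2 <= x -> 1 <= y -> y < x / 2 ->
  M (x - y) * N y <= K * (M x + N x) * y ->
  profile_density M (x - y) * profile_density N y <=
  (profile_density M x + profile_density N x) *
  (512 * K ^+ 4 * ((profile_mass M)^-1 + (profile_mass N)^-1) * profile_weight id y).
Proof.
move=> pM pN K0 x2 y1 yx H.
have x1 : 1 <= x by lra.
have xy1 : 1 <= x - y by lra.
have [x0 y0 xy0] : [/\ 0 < x, 0 < y & 0 < x - y] by split; lra.
have a0 : 0 < (profile_mass M)^-1 by rewrite invr_gt0 profile_mass_gt0.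
have b0 : 0 < (profile_mass N)^-1 by rewrite invr_gt0 profile_mass_gt0.
rewrite !profile_densityE// /profile_weight y1.
set a := (profile_mass M)^-1 in a0 *; set b := (profile_mass N)^-1 in b0 *.
have M0 := le_trans ler01 (profile_ge1 pM x1).
have N0 := le_trans ler01 (profile_ge1 pN x1).
have My0 := le_trans ler01 (profile_ge1 pM xy1).
have Ny0 := le_trans ler01 (profile_ge1 pN y1).
have -> : M (x - y) ^+ 4 / (x - y) ^+ 6 * a * (N y ^+ 4 / y ^+ 6 * b) =
    a * b * ((M (x - y) * N y) ^+ 4 / y ^+ 6) / (x - y) ^+ 6.
  by field; rewrite !gt_eqF.
have P0 : 0 <= M (x - y) * N y by exact: mulr_ge0.
have ab0 : 0 <= a * b by rewrite mulr_ge0 ?ltW.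
apply: (@le_trans _ _ (a * b * ((K * (M x + N x) * y) ^+ 4 / y ^+ 6) / (x / 2) ^+ 6)).
  apply: ler_pM.
  - by rewrite mulr_ge0// divr_ge0// exprn_ge0// ltW.
  - by rewrite invr_ge0 exprn_ge0// ltW.
  - rewrite ler_wpM2l// ler_wpM2r ?invr_ge0 ?exprn_ge0 ?(ltW y0)//.
    by rewrite lerXn2r ?nnegrE// (le_trans P0).
  - rewrite lef_pV2 ?posrE ?exprn_gt0//; last lra.
    by rewrite lerXn2r ?nnegrE ?divr_ge0 ?(ltW x0) ?(ltW xy0)//; lra.
(* The factor 512 is 64, from [x / 2], times 8, from [exprD4_le]. *)
have -> : a * b * ((K * (M x + N x) * y) ^+ 4 / y ^+ 6) / (x / 2) ^+ 6 =
    64 * K ^+ 4 / x ^+ 6 / y ^+ 2 * (a * b * (M x + N x) ^+ 4).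
  by field; rewrite !gt_eqF.
have -> : (M x ^+ 4 / x ^+ 6 * a + N x ^+ 4 / x ^+ 6 * b) *
    (512 * K ^+ 4 * (a + b) * (id y ^+ 4 / y ^+ 6)) =
    64 * K ^+ 4 / x ^+ 6 / y ^+ 2 *
    (8 * ((a * M x ^+ 4 + b * N x ^+ 4) * (a + b))).
  by field; rewrite !gt_eqF.
rewrite ler_wpM2l//.
  by rewrite !divr_ge0 ?mulr_ge0 ?exprn_ge0 ?(ltW x0) ?(ltW y0).
apply: le_trans (ler_wpM2l ab0 (exprD4_le (M x) (N x))) _.
have U0 : 0 <= M x ^+ 4 by exact: exprn_ge0.
have V0 : 0 <= N x ^+ 4 by exact: exprn_ge0.
rewrite mulrCA ler_pM2l//.
have -> : (a * M x ^+ 4 + b * N x ^+ 4) * (a + b) =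
  a * b * (M x ^+ 4 + N x ^+ 4) + (a ^+ 2 * M x ^+ 4 + b ^+ 2 * N x ^+ 4) by ring.
by rewrite lerDl addr_ge0// mulr_ge0// sqr_ge0.
Qed.

Lemma profile_convolution_asymp M N (K : R) : profile M -> profile N -> 0 <= K ->
  (forall x y, 2 <= x -> 1 <= y -> y < x / 2 ->
    M (x - y) * N y <= K * (M x + N x) * y /\
    N (x - y) * M y <= K * (M x + N x) * y) ->
  asymp_equiv (convolution (profile_density M) (profile_density N))
    (fun x => profile_density M x + profile_density N x).
Proof.
move=> pM pN K0 H.
pose c := 512 * K ^+ 4 * ((profile_mass M)^-1 + (profile_mass N)^-1).
have c0 : 0 <= c.
  by rewrite !mulr_ge0 ?exprn_ge0 ?addr_ge0// invr_ge0 ltW// profile_mass_gt0.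
have low y (L : R -> R) : y < 1 -> profile_density L y = 0.
  by move=> y1; rewrite /profile_density /profile_weight ifF ?mul0r//; lra.
apply: (@convolution_asymp _ _ _ (fun y => c * profile_weight id y) 2).
- exact: profile_density_bounded.
- exact: profile_density_bounded.
- exact: profile_long_tailed.
- exact: profile_long_tailed.
- exact: (integrableZl measurableT c (profile_weight_integrable profile_id)).
- move=> x y x2 yx; have [y1|y1] := leP 1 y.
    by apply: profile_density_mul_le => //; have [] := H x y x2 y1 yx.
  rewrite [profile_density N y]low// mulr0 mulr_ge0 ?addr_ge0 ?profile_density_ge0//.
  by rewrite mulr_ge0// profile_weight_ge0.
- move=> x y x2 yx; have [y1|y1] := leP 1 y.
    rewrite [X in _ <= X * _]addrC /c [(profile_mass M)^-1 + _]addrC.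
    apply: profile_density_mul_le => //.
    by rewrite [N x + _]addrC; have [] := H x y x2 y1 yx.
  rewrite [profile_density M y]low// mulr0 mulr_ge0 ?addr_ge0 ?profile_density_ge0//.
  by rewrite mulr_ge0// profile_weight_ge0.
Qed.

Lemma profile_density_not_littleo M N : profile M -> profile N ->
  (forall A : R, exists x, [/\ A <= x, 1 <= x & N x <= M x]) ->
  ~ (profile_density M =o_+oo profile_density N).
Proof.
move=> pM pN H; have mM := profile_mass_gt0 pM; have mN := profile_mass_gt0 pN.
apply: (@not_littleo _ _ _ (profile_mass N / profile_mass M)); first exact: divr_gt0.
move=> A; have [x [Ax x1 NM]] := H A; exists x => //.
have x0 := lt_le_trans ltr01 x1.
have N0 := lt_le_trans ltr01 (profile_ge1 pN x1).
rewrite !profile_densityE//; split; first by rewrite !divr_gt0 ?exprn_gt0.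
have -> : profile_mass N / profile_mass M * (N x ^+ 4 / x ^+ 6 / profile_mass N) =
    N x ^+ 4 / x ^+ 6 / profile_mass M by field; rewrite !gt_eqF.
rewrite !ler_pM2r ?invr_gt0 ?exprn_gt0//.
by rewrite lerXn2r ?nnegrE ?(ltW N0)// (le_trans (ltW N0)).
Qed.

Lemma power_order_eq (p : nat) (f : R -> R) (a : R) : 0 < a ->
  (forall x, 1 <= x -> f x = a / x ^+ p) -> power_order p f.
Proof. by move=> a0 fE; exists a, a, 1; split => // x /fE ->; rewrite lexx. Qed.

Lemma profile_density_power_order2 M N : profile M -> profile N ->
  (forall x, 1 <= x -> x <= M x + N x) ->
  power_order 2 (fun x => profile_density M x + profile_density N x).
Proof.
move=> pM pN MN.
have a0 : 0 < (profile_mass M)^-1 by rewrite invr_gt0 profile_mass_gt0.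
have b0 : 0 < (profile_mass N)^-1 by rewrite invr_gt0 profile_mass_gt0.
pose a := (profile_mass M)^-1; pose b := (profile_mass N)^-1.
exists (Num.min a b / 8), (81 * (a + b)), 1; split.
- by rewrite divr_gt0// lt_min a0.
- by rewrite mulr_gt0// addr_gt0.
move=> x x1; have x0 := lt_le_trans ltr01 x1.
apply/andP; split; last first.
  rewrite mulrAC mulrDr; apply: lerD; rewrite /profile_density ler_pM2r//;
  exact: profile_weight_le.
rewrite !profile_densityE// -/a -/b ler_pdivrMr ?exprn_gt0//.
have -> : (M x ^+ 4 / x ^+ 6 * a + N x ^+ 4 / x ^+ 6 * b) * x ^+ 2 =
   (M x ^+ 4 * a + N x ^+ 4 * b) / x ^+ 4 by field; rewrite gt_eqF.
rewrite ler_pdivlMr ?exprn_gt0//.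
have M0 := le_trans ler01 (profile_ge1 pM x1).
have N0 := le_trans ler01 (profile_ge1 pN x1).
have m0 : 0 < Num.min a b by rewrite lt_min a0.
have h1 : x ^+ 4 <= (M x + N x) ^+ 4.
  by rewrite lerXn2r ?nnegrE ?addr_ge0 ?(ltW x0)// MN.
have h2 := le_trans h1 (exprD4_le _ _).
apply: (@le_trans _ _ (Num.min a b * (M x ^+ 4 + N x ^+ 4))).
  by rewrite -mulrA ler_pM2l//; lra.
by rewrite mulrDr; apply: lerD; rewrite mulrC ler_wpM2l ?exprn_ge0// ge_min lexx ?orbT.
Qed.

Lemma profile_convolution_lt0 M N x : x < 0 ->
  convolution (profile_density M) (profile_density N) x = 0.
Proof.
move=> x0; rewrite /convolution -[RHS](@Rintegral_set0 _ _ _ mu (cst 0)).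
rewrite [RHS]Rintegral_mkcond; apply: eq_Rintegral => y _.
rewrite patch_set0/=; have [y0|y0] := ltP y 0.
  by rewrite [profile_density N y]profile_density_lt0// mulr0.
by rewrite profile_density_lt0 ?mul0r//; lra.
Qed.

Lemma profile_convolution_bounded M N : profile M -> profile N ->
  bounded_density (convolution (profile_density M) (profile_density N)).
Proof.
move=> pM pN; apply: convolution_density; first exact: profile_density_bounded.
by have [] := profile_density_bounded pN.
Qed.

Lemma profile_convolution_long_tailed M N : profile M -> profile N ->
  asymp_equiv (convolution (profile_density M) (profile_density N))
    (fun x => profile_density M x + profile_density N x) ->
  long_tailed (convolution (profile_density M) (profile_density N)).
Proof.
move=> pM pN MN; have [[mh h0 _] _] := profile_convolution_bounded pM pN.
apply: long_tailed_asymp_equiv MN _ => //.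
by apply: long_tailedD; exact: profile_long_tailed.
Qed.

(** If [M + N] dominates [x], both products in the hypothesis of
    [profile_convolution_asymp] are at most [9 * x * y], and the sum of the
    densities is of order [x ^- 2]. *)
Lemma profile_convolution_subexponential M N : profile M -> profile N ->
  (forall x, 1 <= x -> x <= M x + N x) ->
  subexponential (convolution (profile_density M) (profile_density N)).
Proof.
move=> pM pN MN.
have asym : asymp_equiv (convolution (profile_density M) (profile_density N))
    (fun x => profile_density M x + profile_density N x).
  apply: (@profile_convolution_asymp _ _ 9) => // x y x2 y1 yx.
  have x1 : 1 <= x by lra.
  have xy1 : 1 <= x - y by lra.
  have [_ Mb _] := pM; have [_ Nb _] := pN.
  have /andP[_ M1] := Mb _ xy1; have /andP[_ M2] := Mb _ y1.
  have /andP[_ N1] := Nb _ xy1; have /andP[_ N2] := Nb _ y1.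
  have := profile_ge1 pM xy1; have := profile_ge1 pM y1.
  have := profile_ge1 pN xy1; have := profile_ge1 pN y1.
  have := MN _ x1 => h1 h2 h3 h4 h5.
  have h : 9 * (x - y) * y <= 9 * (M x + N x) * y by rewrite ler_wpM2r//; lra.
  split; apply: le_trans h.
    apply: (@le_trans _ _ (3 * (x - y) * (3 * y))); first by apply: ler_pM; lra.
    by rewrite le_eqVlt; apply/orP; left; apply/eqP; ring.
  apply: (@le_trans _ _ (3 * (x - y) * (3 * y))); first by apply: ler_pM; lra.
  by rewrite le_eqVlt; apply/orP; left; apply/eqP; ring.
apply: (@subexponential_power_order _ 2).
- exact: profile_convolution_bounded.
- by move=> x; exact: profile_convolution_lt0.
- exact: profile_convolution_long_tailed.
- apply: power_order_asymp_equiv asym _ _; last exact: profile_density_power_order2.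
  by move=> x; rewrite addr_ge0// profile_density_ge0.
Qed.

End profile_convolutions.

(** * The oscillating profile *)

Section oscillating_profile.
Context {R : realType}.
Implicit Types M N : R -> R.

Lemma sqrt_lipschitz (x z : R) : 1 <= x -> 1 <= z ->
  `|Num.sqrt x - Num.sqrt z| <= `|x - z|.
Proof.
move=> x1 z1; have /andP[sx _] := sqrt_ge1 x1; have /andP[sz _] := sqrt_ge1 z1.
have -> : x - z = (Num.sqrt x - Num.sqrt z) * (Num.sqrt x + Num.sqrt z).
  by rewrite -subr_sqr !sqr_sqrtr//; lra.
by rewrite normrM ler_peMr// ger0_norm; lra.
Qed.

Lemma cos_lipschitz (u v : R) : `|cos u - cos v| <= `|u - v|.
Proof.
wlog uv : u v / v <= u => [H|].
  have [/H//|/ltW/H] := leP v u.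
  by rewrite distrC [`|v - u|]distrC.
have [//|c _ ->] := @MVT_segment R (@cos R) (fun x => - sin x) v u uv.
  by apply: continuous_subspaceT; exact: continuous_cos.
by rewrite normrM normrN ler_piMl// sin_max.
Qed.

Lemma profile_sqrt : profile (@Num.sqrt R).
Proof.
split.
- by apply: continuous_measurable_fun; exact: sqrt_continuous.
- by move=> x x1; rewrite lexx/=; have /andP[] := sqrt_ge1 x1; lra.
- move=> x z x1 z1; apply: le_trans (sqrt_lipschitz x1 z1) _.
  by rewrite ler_peMl// ler1n.
Qed.

(** The oscillation is in [ln x], so that its derivative stays bounded although
    its amplitude is [x]. *)
Definition osc (t x : R) := x * (1 - cos (ln x - t)) + Num.sqrt x.

(** For [z <= x] the three terms are bounded by [2], [1] and [1] times the
    distance; the second one uses [z * (ln x - ln z) <= x - z]. *)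
Lemma osc_lipschitz t (x z : R) : 1 <= x -> 1 <= z ->
  `|osc t x - osc t z| <= 4 * `|x - z|.
Proof.
wlog zx : x z / z <= x => [H x1 z1|x1 z1].
  have [/H->//|/ltW/H] := leP z x.
  by rewrite distrC [`|z - x|]distrC => ->.
have z0 : 0 < z by lra.
have x0 : 0 < x by lra.
set c := cos (ln x - t); set d := cos (ln z - t).
have -> : osc t x - osc t z =
    (x - z) * (1 - c) + z * (d - c) + (Num.sqrt x - Num.sqrt z).
  by rewrite /osc -/c -/d; ring.
have h1 : `|(x - z) * (1 - c)| <= 2 * `|x - z|.
  rewrite normrM mulrC ler_wpM2r//.
  have := cos_geN1 (ln x - t); have := cos_le1 (ln x - t); rewrite -/c => c1 c2.
  by rewrite ger0_norm; lra.
have h2 : `|z * (d - c)| <= `|x - z|.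
  rewrite normrM (gtr0_norm z0) (@ger0_norm _ (x - z)) ?subr_ge0//.
  have lzx : ln z <= ln x by rewrite ler_ln ?posrE.
  have dc : `|d - c| <= ln x - ln z.
    rewrite distrC; apply: le_trans (cos_lipschitz _ _) _.
    by rewrite opprB addrA subrK ger0_norm ?subr_ge0.
  apply: le_trans (ler_wpM2l (ltW z0) dc) _.
  have l1 : ln x - ln z <= x / z - 1.
    have -> : ln x - ln z = ln (1 + (x / z - 1)).
      by rewrite subrKC ln_div ?posrE.
    by apply: le_ln1Dx; rewrite ltrBrDl subrr divr_gt0.
  apply: le_trans (ler_wpM2l (ltW z0) l1) _.
  by rewrite mulrBr mulrCA divff ?gt_eqF// !mulr1.
have h3 := sqrt_lipschitz x1 z1.
apply: le_trans (ler_normD _ _) _.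
have := ler_normD ((x - z) * (1 - c)) (z * (d - c)); lra.
Qed.

Lemma profile_osc t : profile (osc t).
Proof.
split.
- apply: measurable_funD; last first.
    by apply: continuous_measurable_fun; exact: sqrt_continuous.
  apply: measurable_funM; first exact: measurable_id.
  apply: measurable_funB => //.
  apply: (measurableT_comp (f := @cos R)).
    by apply: continuous_measurable_fun; exact: continuous_cos.
  by apply: measurable_funB => //; exact: measurable_ln.
- move=> x x1; have /andP[_ sx] := sqrt_ge1 x1; rewrite /osc.
  have := cos_geN1 (ln x - t); have := cos_le1 (ln x - t) => c1 c2.
  have h0 : 0 <= x * (1 - cos (ln x - t)) by rewrite mulr_ge0//; lra.
  have h2 : x * (1 - cos (ln x - t)) <= x * 2 by rewrite ler_wpM2l//; lra.
  by apply/andP; split; lra.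
- by move=> x z; exact: osc_lipschitz.
Qed.

(** The point is [x = expR (2 * n * pi + t)] with [n] large. *)
Lemma cos_ln_period t (A : R) : 0 <= t -> exists x, [/\ A <= x, 1 <= x &
  forall y : R, cos (ln y - t) = cos (ln x - ln y)].
Proof.
move=> t0; pose n := Num.bound `|A|.
have An : A <= n%:R.
  by apply: le_trans (ler_norm A) _; apply: ltW; exact: archi_boundP.
have pi2 := @pi_ge2 R.
have nu : n%:R <= pi *+ 2 *+ n + t :> R.
  rewrite -[pi *+ 2 *+ n]mulr_natr -[leLHS]mul1r; apply: ler_wpDr => //.
  by rewrite ler_wpM2r// mulr2n; lra.
have n0 : 0 <= n%:R :> R by exact: ler0n.
have eu := expR_ge1Dx (pi *+ 2 *+ n + t).
exists (expR (pi *+ 2 *+ n + t)); split; [lra | lra |] => y.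
rewrite expRK -cosN -(periodicn (@cosD2pi R) n); congr cos; ring.
Qed.

Lemma osc_dip t (A : R) : 0 <= t -> exists x, [/\ A <= x, 1 <= x &
  osc t x = Num.sqrt x].
Proof.
move=> t0; have [x [Ax x1 H]] := cos_ln_period A t0; exists x; split => //.
by rewrite /osc H subrr cos0 subrr mulr0 add0r.
Qed.

Lemma osc_peak (A : R) : exists x, [/\ A <= x, 1 <= x & x <= osc 0 x].
Proof.
have [x [Ax x1 H]] := cos_ln_period A (@pi_ge0 R); exists x; split => //.
have := H x; rewrite subrr cos0 => H1.
have -> : osc 0 x = x * 2 + Num.sqrt x.
  rewrite /osc subr0 -[ln x](subrK pi) cosDpi H1; congr (_ * _ + _); ring.
have := sqrtr_ge0 x; lra.
Qed.

Lemma osc_opposite (x : R) : 1 <= x -> x <= osc 0 x + osc pi x.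
Proof.
move=> x1; rewrite /osc subr0 -{1}[ln x](subrK pi) cosDpi.
have := sqrtr_ge0 x; nra.
Qed.

(** For [y] in the middle third, [ln x - ln y] lies between [ln (3 / 2)]
    and [ln 3], hence in [[0, pi]] and away from 0, which keeps the cosine away
    from 1.  The additional term [s] is small enough to preserve the dips; it
    is either 0 or a density of order [x ^- 4]. *)
Lemma osc_deep_dips t (s : R -> R) (C : R) : 0 <= t -> 0 <= C ->
  (forall x, 0 <= s x) -> (forall x, 1 <= x -> s x <= C / x ^+ 4) ->
  deep_dips (fun x => s x + profile_density (osc t) x).
Proof.
move=> t0 C0 s0 sC.
have pM := profile_osc t.
have a0 : 0 < (profile_mass (osc t))^-1 by rewrite invr_gt0 profile_mass_gt0.
set a := _^-1 in a0.
have l32 : 0 < ln (3 / 2 : R) by apply: ln_gt0; lra.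
have l3 : ln (3 : R) <= pi.
  apply: le_trans (@pi_ge2 R); rewrite -[leRHS]expRK ler_ln ?posrE ?expR_gt0//.
  by have := expR_ge1Dx (2 : R); lra.
have l32' : ln (3 / 2 : R) <= ln 3 by rewrite ler_ln ?posrE; lra.
have k1 : cos (ln (3 / 2)) < 1 :> R.
  by rewrite -[ltRHS]cos0 ltr_cos ?in_itv/= ?lexx ?pi_ge0//; lra.
pose d := (1 - cos (ln (3 / 2 : R))) / 3.
have d0 : 0 < d by rewrite divr_gt0// subr_gt0.
exists (d ^+ 4 * a), (C + a); split.
- by rewrite mulr_gt0// exprn_gt0.
- by rewrite ltr_wpDl.
move=> A; have [x [Ax x1 H]] := cos_ln_period (Num.max A 3) t0.
move: Ax; rewrite ge_max => /andP[Ax x3].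
have x0 : 0 < x by lra.
exists x => //; split.
  rewrite mulrDl; apply: lerD; first exact: sC.
  rewrite profile_densityE// -/a /osc H subrr cos0 subrr mulr0 add0r.
  rewrite (exprM (Num.sqrt x) 2 2) sqr_sqrtr ?(ltW x0)// le_eqVlt; apply/orP; left.
  by apply/eqP; field; rewrite gt_eqF.
move=> y /andP[xy yx].
have y1 : 1 <= y by lra.
have y0 : 0 < y by lra.
apply: (@le_trans _ _ (profile_density (osc t) y)); last by rewrite lerDr.
rewrite profile_densityE// -/a.
have dM : d * x <= osc t y.
  have cl : cos (ln x - ln y) <= cos (ln (3 / 2)).
    have e1 : ln (3 / 2) <= ln x - ln y.
      rewrite -ln_div ?posrE// ler_ln ?posrE ?divr_gt0// ler_pdivlMr//; lra.
    have e2 : ln x - ln y <= ln 3.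
      by rewrite -ln_div ?posrE// ler_ln ?posrE ?divr_gt0// ler_pdivrMr//; lra.
    by rewrite leNgt ltr_cos ?in_itv/= -?leNgt//; lra.
  rewrite /osc H; apply: (@le_trans _ _ (y * (1 - cos (ln x - ln y)))).
    apply: (@le_trans _ _ (x / 3 * (1 - cos (ln (3 / 2))))).
      by rewrite /d le_eqVlt; apply/orP; left; apply/eqP; ring.
    by apply: ler_pM; lra.
  by rewrite lerDl sqrtr_ge0.
rewrite mulrAC ler_pM2r//.
apply: (@le_trans _ _ ((d * x) ^+ 4 / x ^+ 6)).
  by rewrite le_eqVlt; apply/orP; left; apply/eqP; field; rewrite gt_eqF.
have dx0 : 0 <= d * x by rewrite mulr_ge0 ?ltW.
apply: ler_pM; rewrite ?invr_ge0 ?exprn_ge0 ?(ltW x0)//.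
  by rewrite lerXn2r ?nnegrE// (le_trans dx0).
rewrite lef_pV2 ?posrE ?exprn_gt0//.
by rewrite lerXn2r ?nnegrE ?(ltW x0) ?(ltW y0)//; lra.
Qed.

Lemma osc_not_subexponential t : 0 <= t -> ~ subexponential (profile_density (osc t)).
Proof.
move=> t0; apply: deep_dips_not_subexponential.
  exact/profile_density_bounded/profile_osc.
have -> : profile_density (osc t) = (fun x => 0 + profile_density (osc t) x).
  by apply/funext => x; rewrite add0r.
apply: (@osc_deep_dips t (fun=> 0) 0) => // x x1.
by rewrite mul0r.
Qed.

Lemma power_density_subexponential M (p : nat) : profile M ->
  (forall x, 1 <= x -> M x ^+ 4 / x ^+ 6 = 1 / x ^+ p) ->
  subexponential (profile_density M).
Proof.
move=> pM ME; apply: (@subexponential_power_order _ p).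
- exact: profile_density_bounded.
- by move=> x; exact: profile_density_lt0.
- exact: profile_long_tailed.
- apply: (@power_order_eq _ p _ (profile_mass M)^-1).
    by rewrite invr_gt0 profile_mass_gt0.
  by move=> x x1; rewrite profile_densityE// ME// mulrC mulrA mulr1.
Qed.

Lemma sqrt_density_eq (x : R) : 1 <= x -> Num.sqrt x ^+ 4 / x ^+ 6 = 1 / x ^+ 4.
Proof.
move=> x1; rewrite (exprM (Num.sqrt x) 2 2) sqr_sqrtr; last lra.
by field; apply/eqP; lra.
Qed.

(** Here the sum of the profiles is not comparable to [x]; instead
    [Num.sqrt] is nondecreasing, and the Lipschitz bound on [osc t] loses only
    [4 * y * Num.sqrt y <= 4 * y * Num.sqrt x]. *)
Lemma sqrt_osc_convolution_asymp t :
  asymp_equiv (convolution (profile_density Num.sqrt) (profile_density (osc t)))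
    (fun x => profile_density Num.sqrt x + profile_density (osc t) x).
Proof.
have pM := profile_osc t.
apply: (@profile_convolution_asymp _ _ _ 4) => //; first exact: profile_sqrt.
move=> x y x2 y1 yx.
have x1 : 1 <= x by lra.
have xy1 : 1 <= x - y by lra.
have [_ Mb ML] := pM.
have /andP[_ My] := Mb _ y1; have M1 := profile_ge1 pM x1.
have /andP[sy1 sy] := sqrt_ge1 y1.
have /andP[sx1 sx] := sqrt_ge1 x1.
have sxy : Num.sqrt (x - y) <= Num.sqrt x by rewrite ler_wsqrtr//; lra.
have syx : Num.sqrt y <= Num.sqrt x by rewrite ler_wsqrtr//; lra.
split.
  apply: (@le_trans _ _ (Num.sqrt x * (3 * y))).
    by apply: ler_pM; rewrite ?sqrtr_ge0//; have := profile_ge1 pM y1; lra.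
  nra.
have Mxy : osc t (x - y) <= osc t x + 4 * y.
  have := ML _ _ xy1 x1; rewrite (_ : x - y - x = - y); last by ring.
  rewrite normrN (@ger0_norm _ y); last lra.
  by have := ler_norm (osc t (x - y) - osc t x); lra.
apply: (@le_trans _ _ ((osc t x + 4 * y) * Num.sqrt y)).
  by rewrite ler_wpM2r ?sqrtr_ge0.
nra.
Qed.

End oscillating_profile.

(** * The three situations *)

Theorem mainTheorem1 (R : realType) :
  [/\ exists f g : R -> R,
        [/\ prob_density f /\ prob_density g,
            long_tailed f /\ ~ subexponential f,
            long_tailed g /\ ~ subexponential g,
            ~ (f =o_+oo g) /\ ~ (g =o_+oo f) &
            subexponential (convolution f g)],
      exists f g : R -> R,
        [/\ prob_density f /\ prob_density g,
            subexponential f,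
            long_tailed g /\ ~ subexponential g,
            ~ (f =o_+oo g) /\ ~ (g =o_+oo f) &
            subexponential (convolution f g)] &
      exists f g : R -> R,
        [/\ prob_density f /\ prob_density g,
            subexponential f,
            long_tailed g /\ ~ subexponential g,
            ~ (f =o_+oo g) /\ ~ (g =o_+oo f) &
            long_tailed (convolution f g) /\ ~ subexponential (convolution f g)]].
Proof.
have dens M : profile M -> prob_density (@profile_density R M).
  by move=> /profile_density_bounded[].
(* A dip of [osc t] is a point where it is below every profile. *)
have dip_o t M : 0 <= t -> profile M ->
    ~ (@profile_density R M =o_+oo profile_density (osc t)).
  move=> t0 pM; apply: profile_density_not_littleo => //; first exact: profile_osc.
  move=> A; have [x [Ax x1 xE]] := osc_dip A t0; exists x; split => //.
  by rewrite xE; have [_ /(_ x x1)/andP[]] := pM.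
have pi0 := @pi_ge0 R.
have p0 := @profile_osc R 0; have ppi := @profile_osc R pi.
have pid := @profile_id R; have psq := @profile_sqrt R.
have n0 := @osc_not_subexponential R 0 (lexx 0).
split.
- exists (profile_density (osc 0)), (profile_density (osc pi)); split.
  + by split; exact: dens.
  + by split => //; exact: profile_long_tailed.
  + by split; [exact: profile_long_tailed | exact: osc_not_subexponential].
  + by split; apply: dip_o.
  + by apply: profile_convolution_subexponential => // x; exact: osc_opposite.
- exists (profile_density id), (profile_density (osc 0)); split.
  + by split; exact: dens.
  + apply: (@power_density_subexponential _ _ 2) => // x x1.
    by field; apply/eqP; lra.
  + by split => //; exact: profile_long_tailed.
  + split; first exact: dip_o.
    by apply: profile_density_not_littleo => // A; exact: osc_peak.
  + apply: profile_convolution_subexponential => // x x1.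
    by rewrite lerDl (le_trans ler01)// profile_ge1.
- have asym := @sqrt_osc_convolution_asymp R 0.
  have bh := profile_convolution_bounded psq p0.
  exists (profile_density Num.sqrt), (profile_density (osc 0)); split.
  + by split; exact: dens.
  + exact: (@power_density_subexponential _ _ 4 psq sqrt_density_eq).
  + by split => //; exact: profile_long_tailed.
  + split; first exact: dip_o.
    apply: profile_density_not_littleo => // A.
    exists (Num.max A 1); rewrite !le_max !lexx orbT; split => //.
    have [_ /(_ (Num.max A 1))] := p0; rewrite le_max lexx orbT.
    by move=> /(_ isT)/andP[].
  + split; first exact: profile_convolution_long_tailed.
    apply: deep_dips_not_subexponential => //.
    apply: (deep_dips_asymp_equiv asym) => [x|].
      by rewrite addr_ge0// profile_density_ge0.
    apply: (@osc_deep_dips _ 0 _ (profile_mass Num.sqrt)^-1) => //.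
    * by rewrite invr_ge0 ltW// profile_mass_gt0.
    * by move=> x; exact: profile_density_ge0.
    * move=> x x1; rewrite profile_densityE// sqrt_density_eq//.
      by rewrite mulrC mulrA mulr1.
Qed.
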